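(* Let $0<\lambda\le 1$. Let $\epsilon$ and $Z$ be independent real random variables such that $\epsilon\sim\mathcal{G}(0,1)$ and $Z\sim\mathcal{P}(\lambda)$, i.e. $Z$ has the positive stable distribution with parameter $\lambda$. Then $\epsilon+\log Z\sim\mathcal{G}(0,1/\lambda)$.
   Context: ''$\sim$'' means ''is distributed as''. For $\mu\in\mathbb{R}$ and $\beta>0$, $\mathcal{G}(\mu,\beta)$ denotes the Gumbel distribution with location-scale parameters $(\mu,\beta)$, whose cumulative distribution function is $z\mapsto\exp(-\exp(-(z-\mu)/\beta))$. For $0<\lambda\le 1$, $\mathcal{P}(\lambda)$ denotes the positive stable distribution with parameter $\lambda$: the probability distribution on $\mathbb{R}_+$ whose Laplace transform is $\mathbb{E}_{Z\sim\mathcal{P}(\lambda)}[\exp(-tZ)]=\exp(-t^{\lambda})$ for all $t\ge 0$. (Its existence is a known fact. Equivalently to its name, if $Z_1,\dots,Z_N$ are i.i.d. with law $\mathcal{P}(\lambda)$ and $\alpha_1,\dots,\alpha_N>0$, then $(\alpha_1Z_1+\dots+\alpha_NZ_N)/(\alpha_1^\lambda+\dots+\alpha_N^\lambda)^{1/\lambda}\sim\mathcal{P}(\lambda)$.) A variable with law $\mathcal{P}(\lambda)$ is almost surely strictly positive, so $\log Z$ is almost surely well defined. *)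

(* Defs.v *)
From HB Require Import structures.
From mathcomp Require Import all_boot all_order all_algebra.
From mathcomp Require Import all_classical all_reals all_analysis.
From mathcomp Require Import measurable_realfun.

Set Implicit Arguments.
Unset Strict Implicit.
Unset Printing Implicit Defensive.

Import Order.TTheory GRing.Theory Num.Theory.
Import numFieldNormedType.Exports.

Local Open Scope classical_set_scope.
Local Open Scope ring_scope.

(* Makes [ln \o Z] a random variable whenever Z is one; [ln x = 0] for
   [x <= 0]. *)
HB.instance Definition _ (R : realType) :=
  isMeasurableFun.Build _ _ _ _ (@ln R) (@measurable_ln R).

Definition independent_RV d d1 d2 (T : measurableType d)
    (T1 : measurableType d1) (T2 : measurableType d2) (R : realType)
    (P : probability T R) (X : {RV P >-> T1}) (Y : {RV P >-> T2}) : Prop :=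
  forall (A : set T1) (B : set T2), measurable A -> measurable B ->
    P (X @^-1` A `&` Y @^-1` B) = (P (X @^-1` A) * P (Y @^-1` B))%E.

Definition gumbel_cdf (R : realType) (mu beta z : R) : R :=
  expR (- expR (- ((z - mu) / beta))).

(* [X ~ G(mu, beta)], to be used with [0 < beta]. *)
Definition has_gumbel_law d (T : measurableType d) (R : realType)
    (P : probability T R) (mu beta : R) (X : {RV P >-> R}) : Prop :=
  forall z : R, cdf X z = (gumbel_cdf mu beta z)%:E.

(* [Z ~ P(lambda)], to be used with [0 < lambda <= 1]: the law of [Z] is carried
   by the nonnegative reals and has Laplace transform [exp (- t ^ lambda)].
   At [t = 0] the library has [0 `^ lambda = 0], because [lambda != 0]. *)
Definition has_positive_stable_law d (T : measurableType d) (R : realType)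
    (P : probability T R) (lambda : R) (Z : {RV P >-> R}) : Prop :=
  {ae P, forall w, 0 <= Z w} /\
  forall t : R, 0 <= t ->
    'E_P[fun w => expR (- (t * Z w))]%E = (expR (- (t `^ lambda)))%:E.

Arguments independent_RV {d d1 d2 T T1 T2 R} P X Y.
Arguments has_gumbel_law {d T R} P mu beta X.
Arguments has_positive_stable_law {d T R} P lambda Z.

(* Main.v *)
Require Import Defs.
From HB Require Import structures.
From mathcomp Require Import all_boot all_order all_algebra.
From mathcomp Require Import all_classical all_reals all_analysis.
From mathcomp Require Import measurable_realfun.
Import Order.TTheory GRing.Theory Num.Theory.
Import numFieldNormedType.Exports.
Local Open Scope classical_set_scope.
Local Open Scope ring_scope.

(** The Gumbel distribution function turns a logarithm into an exponential:
    for [0 < x], the event [eps + ln x <= z] has probability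
    [exp (- exp (- (z - ln x))) = exp (- exp (- z) * x)], which is the
    integrand of a Laplace transform.  Averaging over the independent [Z]
    ([prob_independent_pair]) therefore gives the Laplace transform of [Z] at
    [t = exp (- z)], that is
    [exp (- t ^ lambda) = exp (- exp (- (lambda * z)))], which is the
    distribution function of [G(0, 1 / lambda)] at [z].

    The identity [exp (ln x) = x] needs [0 < x], so that [Z] must almost surely
    avoid the nonpositive half-line.  This too is read off the Laplace
    transform, which tends to [0] at infinity ([positive_stable_gt0]). *)

(** Independence says that the joint law of [(X, Y)] and the product of the
    marginals agree on rectangles, hence everywhere; the formula is then
    Tonelli's theorem, with the section variable [y] replaced by [Y w]. *)
Lemma prob_independent_pair {d d1 d2 : measure_display}
    {T : measurableType d} {T1 : measurableType d1} {T2 : measurableType d2}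
    {R : realType} {P : probability T R}
    (X : {RV P >-> T1}) (Y : {RV P >-> T2}) (A : set (T1 * T2)) :
  independent_RV P X Y -> measurable A ->
  P [set w | A (X w, Y w)] =
    (\int[P]_w distribution P X (ysection A (Y w)))%E.
Proof.
move=> indXY mA.
have mXY : measurable_fun setT (fun w => (X w, Y w)).
  by apply/measurable_fun_pairP; split.
pose XY : {mfun T >-> (T1 * T2)%type} :=
  HB.pack (fun w => (X w, Y w)) (isMeasurableFun.Build _ _ _ _ _ mXY).
transitivity ((distribution P X \x distribution P Y)%E A).
  by rewrite (@product_measure_unique _ _ _ _ _ _ _ (distribution P XY)).
transitivity ((distribution P X \x^ distribution P Y)%E A).
  apply: product_measure_unique => // B C mB mC.
  exact: product_measure2E.
rewrite /product_measure2 ge0_integral_distribution//.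
exact: measurable_fun_ysection.
Qed.

(** On [Z <= 0] the function [exp (- t Z)] is at least [1], so that
    [P (Z <= 0) <= exp (- t ^ lambda)] for all [0 <= t]. *)
Lemma positive_stable_gt0 {d : measure_display} {T : measurableType d}
    {R : realType} {P : probability T R} (lambda : R) (Z : {RV P >-> R}) :
  0 < lambda -> has_positive_stable_law P lambda Z ->
  {ae P, forall w, 0 < Z w}.
Proof.
move=> l0 [_ laplaceZ].
pose N := Z @^-1` `]-oo, 0].
have mN : measurable N by rewrite -[N]setTI; exact: measurable_funPT.
have PN_le (s : R) : 0 <= s -> (P N <= (expR (- s))%:E)%E.
  move=> s0.
  have -> : s = (s `^ lambda^-1) `^ lambda.
    by rewrite -powRrM mulVf ?gt_eqF// powRr1.
  rewrite -laplaceZ ?powR_ge0// unlock -[N]setIT -integral_indic//.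
  apply: ge0_le_integral => //.
  - by apply/measurable_EFinP; exact: measurable_indic.
  - by apply/measurable_EFinP; apply: measurableT_comp => //;
      apply: measurableT_comp => //; exact: measurable_funM.
  - move=> w _; rewrite lee_fin indicE; case: (boolP (w \in N)) => [|_].
      rewrite inE /N/= in_itv/= => Zw.
      by rewrite leNgt expR_lt1 -leNgt oppr_ge0 mulr_ge0_le0 ?powR_ge0.
    by rewrite expR_ge0.
have PN0 : P N = 0%E.
  have PNfin : P N \is a fin_num by exact: fin_num_measure.
  apply/eqP; rewrite eq_le measure_ge0 andbT leNgt; apply/negP => PN_gt0.
  have p_gt0 : 0 < fine (P N) by rewrite fine_gt0// PN_gt0 ltey_eq PNfin.
  have p_le1 : fine (P N) <= 1.
    by rewrite -lee_fin fineK// probability_le1.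
  have s_ge0 : 0 <= 1 - ln (fine (P N)).
    by rewrite subr_ge0 (le_trans (ln_le0 p_le1)).
  (* With p = P N > 0, this s makes exp (- s) = p / e < p. *)
  have := PN_le _ s_ge0.
  rewrite -[X in (X <= _)%E]fineK// lee_fin opprB expRD lnK ?posrE//.
  by rewrite ler_pMr// leNgt expR_lt1 ltrN10.
exists N; split => // w /=.
by move/negP; rewrite -leNgt /N/= in_itv.
Qed.

Theorem mainTheorem1 (R : realType) (d : measure_display)
    (T : measurableType d) (P : probability T R)
    (lambda : R) (eps Z : {RV P >-> R}) :
  0 < lambda -> lambda <= 1 ->
  independent_RV P eps Z ->
  has_gumbel_law P 0 1 eps ->
  has_positive_stable_law P lambda Z ->
  has_gumbel_law P 0 (1 / lambda) (eps \+ (@ln R \o Z)).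
Proof.
move=> l0 _ indep gumbel stable z.
have Z_gt0 := positive_stable_gt0 _ _ l0 stable.
pose A := [set p : R * R | p.1 + ln p.2 <= z].
have mA : measurable A.
  have mf : measurable_fun [set: R * R] (fun p : R * R => p.1 + ln p.2).
    by apply: measurable_funD => //; exact: measurableT_comp.
  rewrite (_ : A = (fun p : R * R => p.1 + ln p.2) @^-1` `]-oo, z]).
    by rewrite -[X in measurable X]setTI; exact: mf.
  by apply/seteqP; split => p; rewrite /A/= in_itv.
have sectionA y : distribution P eps (ysection A y) =
    (expR (- expR (ln y - z)))%:E.
  have -> : expR (- expR (ln y - z)) = gumbel_cdf 0 1 (z - ln y).
    by rewrite /gumbel_cdf subr0 divr1 opprB.
  rewrite -gumbel /cdf; congr (distribution P eps _).
  by apply/seteqP; split => x; rewrite /ysection/= inE /A/= in_itv/= lerBrDr.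
transitivity (P [set w | A (eps w, Z w)]).
  by congr (P _); apply/seteqP; split => w; rewrite /A/= in_itv.
rewrite (prob_independent_pair _ _ _ indep mA).
under eq_integral do rewrite sectionA.
transitivity ('E_P[fun w => expR (- (expR (- z) * Z w))])%E; last first.
  rewrite stable.2 ?expR_ge0// -expRM /gumbel_cdf.
  by rewrite subr0 div1r invrK mulNr.
rewrite unlock; apply: ge0_ae_eq_integral => //.
- apply/measurable_EFinP; apply: measurableT_comp => //.
  apply: measurableT_comp => //; apply: measurableT_comp => //.
  by apply: measurable_funB => //; exact: measurableT_comp.
- by apply/measurable_EFinP; apply: measurableT_comp => //;
    apply: measurableT_comp => //; exact: measurable_funM.
- apply: filterS Z_gt0 => w Zw _.
  by rewrite addrC expRD lnK ?posrE.
Qed.
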